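(* Let $\mathfrak{L}=\mathfrak{I}\oplus\mathfrak{V}$ be a Leibniz algebra over a field $\mathbb{F}$ admitting a multiplicative basis $\mathcal{B}=\mathcal{B}_{\mathfrak{I}}\,\dot\cup\,\mathcal{B}_{\mathfrak{V}}$, where $\mathcal{B}_{\mathfrak{I}}=\{e_k\}_{k\in K}$ and $\mathcal{B}_{\mathfrak{V}}=\{u_j\}_{j\in J}$. Then $\mathcal{B}$ is of weak division if and only if both subgraphs $\Gamma(\mathfrak{L},\mathcal{B}_{\mathfrak{I}})$ and $\Gamma(\mathfrak{L},\mathcal{B}_{\mathfrak{V}})$ are weakly symmetric.
   Context: A Leibniz algebra $\mathfrak{L}$ over an arbitrary field $\mathbb{F}$ is a vector space (of arbitrary dimension) with a bilinear product $[\cdot,\cdot]$ satisfying $[[y,z],x]=[[y,x],z]+[y,[z,x]]$ for all $x,y,z\in\mathfrak{L}$. An ideal of $\mathfrak{L}$ is a subspace $S$ (in particular a subalgebra) with $[S,\mathfrak{L}]+[\mathfrak{L},S]\subset S$. For $v\in\mathfrak{L}$, $\mathcal{I}(v)$ denotes the ideal of $\mathfrak{L}$ generated by $v$. Let $\mathfrak{I}$ be the ideal generated by $\{[x,x]:x\in\mathfrak{L}\}$; it satisfies $[\mathfrak{L},\mathfrak{I}]=0$. Let $\mathfrak{V}$ be a linear complement of $\mathfrak{I}$, so $\mathfrak{L}=\mathfrak{I}\oplus\mathfrak{V}$. Multiplicative basis: a basis $\mathcal{B}=\mathcal{B}_{\mathfrak{I}}\,\dot\cup\,\mathcal{B}_{\mathfrak{V}}$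 of $\mathfrak{L}$, where $\mathcal{B}_{\mathfrak{I}}=\{e_k\}_{k\in K}$ is a basis of $\mathfrak{I}$ and $\mathcal{B}_{\mathfrak{V}}=\{u_j\}_{j\in J}$ is a basis of $\mathfrak{V}$, is called multiplicative if (i) for any $k\in K$, $j\in J$ we have $[e_k,u_j]\in\mathbb{F}e_i$ for some $i\in K$; and (ii) for any $j,k\in J$ either $[u_j,u_k]\in\mathbb{F}u_l$ for some $l\in J$, or $[u_j,u_k]\in\mathbb{F}e_i$ for some $i\in K$. Graphs: $\Gamma(\mathfrak{L},\mathcal{B})=(V,E)$ is the directed graph with $V=\mathcal{B}$ and $E=\{(v,v')\in V\times V:\{[w,v],[v,w]\}\cap\mathbb{F}^{\times}v'\neq\emptyset\text{ for some }w\in\mathcal{B}\}$, $\mathbb{F}^\times=\mathbb{F}\setminus\{0\}$. $\Gamma(\mathfrak{L},\mathcal{B}_{\mathfrak{I}})$ and $\Gamma(\mathfrak{L},\mathcal{B}_{\mathfrak{V}})$ are the vertex-induced subgraphs of $\Gamma(\mathfrak{L},\mathcal{B})$ on the vertex sets $\mathcal{B}_{\mathfrak{I}}$ and $\mathcal{B}_{\mathfrak{V}}$ respectively (all edges of $\Gamma(\mathfrak{L},\mathcal{B})$ with both endpoints in the given set). A directed path from $v$ to $v'$ is a finite sequence of vertices starting at $v$ and ending at $v'$ in which each pair of consecutive vertices $(w,w')$ is an edge; there is always a directed path using no edges from a vertex to itself. A graph is weakly symmetric if for every edge $(v,v')$ there exists a directed path (in that graph) from $v'$ to $v$. Weak division: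 $\mathcal{B}$ is of weak division if, for $e_i,e_k\in\mathcal{B}_{\mathfrak{I}}$, $u_j\in\mathcal{B}_{\mathfrak{V}}$ and $\lambda\in\mathbb{F}$, $0\neq[e_i,u_j]=\lambda e_k$ implies $e_i\in\mathcal{I}(e_k)$; and for $u_i,u_k,u_p\in\mathcal{B}_{\mathfrak{V}}$ and $\lambda\in\mathbb{F}$, $0\neq[u_i,u_k]=\lambda u_p$ implies $u_i,u_k\in\mathcal{I}(u_p)$. *)

(* Defs.v *)
From mathcomp Require Export all_boot all_order all_algebra sesquilinear.
From mathcomp Require Export boolp classical_sets.

Set Implicit Arguments.
Unset Strict Implicit.
Unset Printing Implicit Defensive.

Import GRing.Theory.
Local Open Scope ring_scope.
Local Open Scope classical_set_scope.

Section LinearAlgebra.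
Context {F : fieldType} {L : lmodType F}.
Implicit Types (S T : set L).

Definition subspace S : Prop := submod_closed [in S].

Definition linear_complement S T : Prop :=
  [/\ subspace T, S `&` T = [set 0] &
      forall x, exists s t, [/\ S s, T t & x = s + t]].

(* Finite linear combinations of a family are indexed by injections
   f : 'I_n -> K, so that the index type K may be arbitrary. *)
Definition free_family (K : Type) (e : K -> L) : Prop :=
  forall (n : nat) (f : 'I_n -> K) (c : 'I_n -> F), injective f ->
    \sum_(i < n) c i *: e (f i) = 0 -> forall i, c i = 0.

Definition spanned_by (K : Type) (e : K -> L) (x : L) : Prop :=
  exists (n : nat) (f : 'I_n -> K) (c : 'I_n -> F),
    injective f /\ x = \sum_(i < n) c i *: e (f i).

Definition family_basis (S : set L) (K : Type) (e : K -> L) : Prop :=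
  [/\ range e `<=` S, free_family e & S `<=` spanned_by e].

End LinearAlgebra.

Section Leibniz.
Context {F : fieldType} {L : lmodType F}.
Variable br : {bilinear L -> L -> L}.

Definition leibniz_identity : Prop :=
  forall x y z, br (br y z) x = br (br y x) z + br y (br z x).

Definition ideal (S : set L) : Prop :=
  subspace S /\ forall s x, S s -> S (br s x) /\ S (br x s).

Definition generated_ideal (G : set L) : set L := smallest ideal G.

Definition squares_ideal : set L := generated_ideal [set br x x | x in setT].

Section Bases.
Context {K J : Type}.
Variables (e : K -> L) (u : J -> L).

Definition multiplicative_basis (V : set L) : Prop :=
  [/\ family_basis squares_ideal e,
      family_basis V u,
      forall k j, exists i a, br (e k) (u j) = a *: e i &
      forall j k, (exists l a, br (u j) (u k) = a *: u l) \/
                  (exists i a, br (u j) (u k) = a *: e i)].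

Definition weak_division : Prop :=
  (forall i k j a, br (e i) (u j) != 0 -> br (e i) (u j) = a *: e k ->
     generated_ideal [set e k] (e i)) /\
  (forall i k p a, br (u i) (u k) != 0 -> br (u i) (u k) = a *: u p ->
     generated_ideal [set u p] (u i) /\ generated_ideal [set u p] (u k)).

End Bases.
End Leibniz.

Record digraph (T : Type) := Digraph { vertices : set T; edges : set (T * T) }.

Definition induced_subgraph (T : Type) (G : digraph T) (S : set T) : digraph T :=
  Digraph (vertices G `&` S) (edges G `&` (S `*` S)).

(* The path is x :: s; the path with s empty uses no edge. *)
Definition has_dipath (T : eqType) (G : digraph T) (x y : T) : Prop :=
  exists s : seq T,
    [/\ {subset x :: s <= vertices G},
        path (fun v w => (v, w) \in edges G) x s &
        last x s = y].

Definition weakly_symmetric (T : eqType) (G : digraph T) : Prop :=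
  forall v w, edges G (v, w) -> has_dipath G w v.

Definition product_graph {F : fieldType} {L : lmodType F}
    (br : {bilinear L -> L -> L}) (B : set L) : digraph L :=
  Digraph B
    [set p | [/\ B p.1, B p.2 &
       exists2 w, B w &
         [set br w p.1; br p.1 w] `&` [set a *: p.2 | a in [set a | a != 0]]
           !=set0]].

(* Main.v *)
Require Import Defs.

Set Implicit Arguments.
Unset Strict Implicit.
Unset Printing Implicit Defensive.

Import GRing.Theory.
Local Open Scope ring_scope.
Local Open Scope classical_set_scope.

(** Since [L, I] = 0, an edge of the graph on the e's comes from a product
    [e_k, u_j], an edge of the graph on the u's from a product of two u's, and
    the target of any edge lies in the ideal generated by its source. Hence a
    directed path from x to y gives y in I(x), which proves that weak symmetry
    implies weak division. Conversely, the span of the e's reachable from e_k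
    is an ideal, and so is I plus the span of the u's reachable from u_i; by
    linear independence, a basis element lying in I(e_k) or I(u_i), and of the
    same kind, is reachable, so weak division provides the return paths. *)

(** * Subspaces, spans and linear independence *)

Lemma subspaceP (F : fieldType) (L : lmodType F) (S : set L) :
  subspace S <-> S 0 /\ forall a x y, S x -> S y -> S (a *: x + y).
Proof.
split=> -[S0 Slin]; split; try by [rewrite inE | move: S0; rewrite inE].
  by move=> a x y Sx Sy; have := Slin a x y; rewrite !inE; apply.
by move=> a x y; rewrite !inE; exact: Slin.
Qed.

Section Subspaces.
Context {F : fieldType} {L : lmodType F}.
Implicit Types (S T G : set L).

Lemma subspace0 S : subspace S -> S 0.
Proof. by move=> /subspaceP []. Qed.

Lemma subspaceZ S a x : subspace S -> S x -> S (a *: x).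
Proof. by move=> /subspaceP [S0 Slin] Sx; rewrite -[_ *: _]addr0; apply: Slin. Qed.

Lemma subspaceD S x y : subspace S -> S x -> S y -> S (x + y).
Proof.
by move=> /subspaceP [S0 Slin] Sx Sy; rewrite -[x]scale1r; apply: Slin.
Qed.

Lemma subspaceB S x y : subspace S -> S x -> S y -> S (x - y).
Proof.
by move=> hS Sx Sy; rewrite -scaleN1r; apply: subspaceD => //; apply: subspaceZ.
Qed.

Lemma subspace_smallest G : subspace (smallest subspace G).
Proof.
apply/subspaceP; split=> [T [hT _]|a x y Sx Sy T [hT GT]].
  exact: subspace0.
by have /subspaceP[_ Tlin] := hT; apply: Tlin; [exact: (Sx T) | exact: (Sy T)].
Qed.

Lemma subspaceI S T : subspace S -> subspace T -> subspace (S `&` T).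
Proof.
move=> /subspaceP[S0 Slin] /subspaceP[T0 Tlin]; apply/subspaceP; split=> //.
by move=> a x y [Sx Tx] [Sy Ty]; split; [apply: Slin | apply: Tlin].
Qed.

Lemma spanned_by_sub (K : Type) (e : K -> L) S x :
  subspace S -> range e `<=` S -> spanned_by e x -> S x.
Proof.
move=> hS eS [n [f [c [_ ->]]]]; elim/big_ind: _ => [||i _].
- exact: subspace0.
- by move=> y z; exact: subspaceD.
- by apply: subspaceZ => //; apply: eS; exists (f i).
Qed.

(** Collecting the terms with equal index turns a list with repetitions into a combination over
    distinct indices, to which freeness applies. Unlike injective families, such lists are added by
    mere concatenation. *)
Lemma free_familyP (K : eqType) (e : K -> L) (s : seq (F * K)) (k : K) :
  free_family e -> \sum_(p <- s) p.1 *: e p.2 = 0 ->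
  \sum_(p <- s | p.2 == k) p.1 = 0.
Proof.
move=> efree s0.
set t := undup [seq p.2 | p <- s].
pose c k := \sum_(p <- s | p.2 == k) p.1.
have st : \sum_(k <- t) c k *: e k = 0.
  rewrite -[RHS]s0; under eq_bigr do rewrite scaler_suml.
  rewrite (exchange_big_dep xpredT) //=; apply: eq_big_seq => p ps.
  have pt : p.2 \in t by rewrite mem_undup map_f.
  under eq_bigl do rewrite eq_sym.
  by rewrite -big_filter filter_pred1_uniq ?undup_uniq // big_seq1.
have [kt|kt] := boolP (k \in t); last first.
  rewrite big_seq_cond big1 // => p /andP[ps /eqP pk]; move: kt.
  by rewrite mem_undup -pk map_f.
(* The entries of the duplicate-free list [t] form the injective family of indices required by
   [free_family]. *)
have := efree (size t) (tnth (in_tuple t)) (fun i => c (tnth (in_tuple t) i)).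
rewrite -(big_tnth _ _ t predT (fun k => c k *: e k)) => /(_ _ st).
have /tnthP[i ->] : k \in in_tuple t by [].
by apply; apply/tuple_uniqP; exact: undup_uniq.
Qed.

Lemma free_family_mem_span (K : Type) (e : K -> L) (P : set K) k :
  free_family e -> smallest subspace (e @` P) (e k) -> P k.
Proof.
move=> efree; apply: contraPP => nPk /=.
(* Classical equality on [K] lets coefficients be collected by index. *)
pose K' : eqType := {classic K}.
pose S := [set x : L | exists2 s : seq (F * K'),
  (forall p, p \in s -> P p.2) & x = \sum_(p <- s) p.1 *: e p.2].
have hS : subspace S.
  apply/subspaceP; split; first by exists [::]; rewrite ?big_nil.
  move=> a _ _ [s Ps ->] [t Pt ->].
  exists ([seq (a * p.1, p.2) | p <- s] ++ t).
    by move=> p; rewrite mem_cat => /orP[/mapP[q qs ->]|/Pt//]; exact: (Ps q).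
  rewrite big_cat big_map scaler_sumr /=; congr (_ + _).
  by apply: eq_bigr => p _; rewrite scalerA.
have eS : e @` P `<=` S.
  move=> _ [l Pl <-]; exists [:: (1, l : K')].
    by move=> p; rewrite inE => /eqP ->.
  by rewrite big_seq1 scale1r.
move=> /(smallest_sub hS eS) [s Ps es].
(* Moving [e k] to the other side gives a vanishing combination whose total coefficient at [k] is
   -1, since [k] is not in [P] and so does not occur in [s]. *)
have := @free_familyP K' e ((-1, k : K') :: s) k efree.
rewrite big_cons /= scaleN1r -es addNr big_cons /= eqxx.
rewrite [X in _ + X]big_seq_cond big1 => [/(_ erefl)/eqP|p /andP[ps /eqP pk]].
  by rewrite addr0 oppr_eq0 oner_eq0.
by case: nPk; rewrite -pk; exact: Ps.
Qed.

End Subspaces.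

Lemma subspace_preimage (F : fieldType) (L M : lmodType F)
    (f : {linear L -> M}) (S : set M) :
  subspace S -> subspace (f @^-1` S).
Proof.
move=> hS; apply/subspaceP; split=> /= [|a x y Sx Sy].
  by rewrite linear0; exact: subspace0.
by rewrite linearP; apply: subspaceD => //; apply: subspaceZ.
Qed.

(** * Generated ideals and the edges of the product graph *)

Section Ideals.
Context {F : fieldType} {L : lmodType F}.
Variable br : {bilinear L -> L -> L}.
Implicit Types (S G B : set L).

Lemma ideal_generated_ideal G : ideal br (generated_ideal br G).
Proof.
split.
  apply/subspaceP; split=> [T [[hT _] _]|a x y Sx Sy T [[hT brT] GT]].
    exact: subspace0.
  by have /subspaceP[_ Tlin] := hT; apply: Tlin; [apply: Sx | apply: Sy].
move=> s x Is; split=> T [[hT brT] GT]; have Ts : T s by apply: Is.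
  by have [] := brT s x Ts.
by have [] := brT s x Ts.
Qed.

Lemma generated_ideal_trans x y z :
  generated_ideal br [set x] y -> generated_ideal br [set y] z ->
  generated_ideal br [set x] z.
Proof.
by move=> xy; apply: smallest_sub => [|_ ->//]; exact: ideal_generated_ideal.
Qed.

(** The vectors whose products with a fixed vector, on both sides, stay in a given subspace form a
    subspace. This reduces first the outer factor to [B], then the inner one to [G]. *)
Lemma ideal_span G B :
  smallest subspace B = setT ->
  (forall g b, G g -> B b ->
     smallest subspace G (br g b) /\ smallest subspace G (br b g)) ->
  ideal br (smallest subspace G).
Proof.
set S := smallest subspace G => Bfull GB.
have hS : subspace S by exact: subspace_smallest.
split=> // s x Ss.
have Gx g : G g -> S (br g x) /\ S (br x g).
  move=> Gg.
  have hT := subspaceI (subspace_preimage (br g : {linear L -> L}) hS)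
                       (subspace_preimage (applyr br g : {linear L -> L}) hS).
  have : smallest subspace B x by rewrite Bfull.
  by move=> /(smallest_sub hT); apply=> b Bb; exact: GB.
have hT := subspaceI (subspace_preimage (br x : {linear L -> L}) hS)
                     (subspace_preimage (applyr br x : {linear L -> L}) hS).
suff /(_ _ Ss)[] : S `<=` br x @^-1` S `&` applyr br x @^-1` S by [].
by apply: smallest_sub hT _ => g /Gx[].
Qed.

Lemma product_graph_edgeE B v w :
  edges (product_graph br B) (v, w) <->
  [/\ B v, B w & exists b a, [/\ B b, a != 0 &
    br b v = a *: w \/ br v b = a *: w]].
Proof.
split=> -[Bv Bw].
  move=> [b Bb [_ [[] -> [a a0 /= h]]]]; split=> //; exists b, a; split=> //.
    by left.
  by right.
move=> [b [a [Bb a0 h]]]; split=> //; exists b => //; exists (a *: w).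
by split; [case: h => <-; [left|right] | exists a].
Qed.

(** The product with [v] that defines the edge lies in the ideal of [v], and its nonzero scalar can
    be inverted. *)
Lemma product_graph_edge_ideal B v w :
  edges (product_graph br B) (v, w) -> generated_ideal br [set v] w.
Proof.
move=> /product_graph_edgeE[_ _ [b [a [_ a0 h]]]].
have [Isub Ibr] := ideal_generated_ideal [set v].
have Iv : generated_ideal br [set v] v by exact: sub_gen_smallest.
have {}h : generated_ideal br [set v] (a *: w).
  by have [? ?] := Ibr v b Iv; case: h => <-.
by rewrite -[w]scale1r -(mulVf a0) -scalerA; exact: (subspaceZ _ Isub h).
Qed.

Lemma has_dipath_ideal B S v w :
  has_dipath (induced_subgraph (product_graph br B) S) v w ->
  generated_ideal br [set v] w.
Proof.
move=> [s [_ + <-]]; elim: s v => /= [v _|y s IHs v /andP[vy ys]].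
  exact: sub_gen_smallest.
apply: generated_ideal_trans (IHs _ ys).
by move: vy; rewrite inE => -[/product_graph_edge_ideal].
Qed.

End Ideals.

(** * Directed paths *)

Lemma has_dipath_refl (T : eqType) (G : digraph T) x :
  vertices G x -> has_dipath G x x.
Proof.
by move=> Gx; exists [::]; split=> // y; rewrite !inE => /eqP ->.
Qed.

Lemma has_dipath_rcons (T : eqType) (G : digraph T) x y z :
  has_dipath G x y -> edges G (y, z) -> vertices G z -> has_dipath G x z.
Proof.
move=> [s [sG xs <-]] yz Gz; exists (rcons s z); split.
- move=> t; rewrite -rcons_cons mem_rcons inE => /orP[/eqP->|/sG//].
  by rewrite inE.
- by rewrite rcons_path xs inE.
- by rewrite last_rcons.
Qed.

(** * The ideal of squares, and which products give edges *)

Section Leibniz.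
Context {F : fieldType} {L : lmodType F}.
Variable br : {bilinear L -> L -> L}.
Hypothesis hL : leibniz_identity br.
Local Notation I := (squares_ideal br).

(** The vectors killed by every left multiplication form an ideal that contains all squares. *)
Lemma br_squares_ideal x s : I s -> br x s = 0.
Proof.
move=> Is.
pose Z := [set s | forall y, br y s = 0].
suff: Z s by apply.
move: Is; apply: smallest_sub.
  split; first apply/subspaceP.
    split=> [y|a t t' Zt Zt' y]; first exact: linear0r.
    by rewrite linearPr Zt Zt' scaler0 addr0.
  move=> t y Zt; split=> z; last by rewrite Zt linear0r.
  (* For [t] in [Z], two of the three terms of the identity vanish, and [br z (br t y)] remains. *)
  by have := hL y z t; rewrite !Zt linear0l add0r.
move=> _ [y _ <-] z.
(* With [y] repeated, two terms of the identity cancel, and [br z (br y y)] remains. *)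
by have /eqP := hL y z y; rewrite addrC -subr_eq subrr => /eqP.
Qed.

Section MultiplicativeBasis.
Context {V : set L} {K J : Type} {e : K -> L} {u : J -> L}.
Hypothesis hV : linear_complement I V.
Hypothesis hB : multiplicative_basis br e u V.
Local Notation B := (range e `|` range u).
Local Notation Gamma := (product_graph br B).

Lemma squares_ideal_e k : I (e k).
Proof. by case: hB => -[+ _ _] _ _ _; apply; exists k. Qed.

Lemma complement_u j : V (u j).
Proof. by case: hB => _ [+ _ _] _ _; apply; exists j. Qed.

Lemma squares_ideal_brl s x : I s -> I (br s x).
Proof.
move=> Is.
by have [_ /(_ s x Is)[]] := ideal_generated_ideal br [set br x x | x in setT].
Qed.

Lemma free_e : free_family e. Proof. by case: hB => -[]. Qed.

Lemma free_u : free_family u. Proof. by case: hB => _ []. Qed.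

Lemma mem_I_V x : I x -> V x -> x = 0.
Proof. by case: hV => _ IV _ Ix Vx; have : [set 0] x by rewrite -IV. Qed.

Lemma u_notin_squares_ideal j : ~ I (u j).
Proof.
move=> Iuj; have uj0 := mem_I_V Iuj (complement_u j).
(* With the empty index set the span is zero, so a zero member of a free family would have its index
   in [set0]. *)
apply: (@free_family_mem_span _ _ _ u set0 j free_u).
by rewrite uj0; exact: (subspace0 (subspace_smallest _)).
Qed.

Lemma basis_full : smallest subspace B = setT.
Proof.
have hS := subspace_smallest B.
apply/seteqP; split=> // x _.
have [_ _ /(_ x)[s [t [Is Vt ->]]]] := hV.
have [[_ _ Ie] [_ _ Vu] _ _] := hB.
apply: (subspaceD hS).
  apply: (spanned_by_sub hS _ (Ie _ Is)) => y ye.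
  by apply: sub_gen_smallest; left.
apply: (spanned_by_sub hS _ (Vu _ Vt)) => y yu.
by apply: sub_gen_smallest; right.
Qed.

Lemma scale_e_neq0 a k : a != 0 -> a *: e k != 0.
Proof.
move=> a0; rewrite scaler_eq0 (negPf a0) /=; apply/eqP => ek0.
apply: (@free_family_mem_span _ _ _ e set0 k free_e).
by rewrite ek0; exact: (subspace0 (subspace_smallest _)).
Qed.

Lemma scale_notin_squares_ideal a j : a != 0 -> ~ I (a *: u j).
Proof.
move=> a0 /(subspaceZ a^-1 (proj1 (ideal_generated_ideal _ _))).
by rewrite scalerA mulVf // scale1r => /u_notin_squares_ideal.
Qed.

Lemma edge_eP k l :
  edges (induced_subgraph Gamma (range e)) (e k, e l) <->
  exists j a, a != 0 /\ br (e k) (u j) = a *: e l.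
Proof.
split=> [[/product_graph_edgeE[_ _ [b [a [Bb a0 h]]]] _]|[j [a [a0 h]]]].
  have /eqP := scale_e_neq0 l a0.
  (* Products with right factor in [I] vanish, whereas the target [a *: e l] does not; only a right
     factor [u j] survives. *)
  case: h => [<-|h]; first by rewrite br_squares_ideal //; exact: squares_ideal_e.
  move: Bb h => [] [j _ <-] h; last by exists j, a.
  by rewrite -h br_squares_ideal //; exact: squares_ideal_e.
split; last by split; [exists k | exists l].
apply/product_graph_edgeE; split; try by left; eexists.
by exists (u j), a; split=> //; [right; exists j | right].
Qed.

Lemma edge_uP i p :
  edges (induced_subgraph Gamma (range u)) (u i, u p) <->
  exists j a, a != 0 /\ (br (u j) (u i) = a *: u p \/ br (u i) (u j) = a *: u p).
Proof.
split=> [[/product_graph_edgeE[_ _ [b [a [Bb a0 h]]]] _]|[j [a [a0 h]]]].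
  move: Bb h => [] [j _ <-] h; last by exists j, a.
  (* A product with a factor [e j] lies in [I], which contains no nonzero multiple of [u p]. *)
  case: (scale_notin_squares_ideal (j := p) a0).
  have Iej := squares_ideal_e j.
  case: h => <-; first exact: squares_ideal_brl.
  rewrite br_squares_ideal //.
  exact: (subspace0 (proj1 (ideal_generated_ideal _ _))).
split; last by split; [exists i | exists p].
apply/product_graph_edgeE; split; try by right; eexists.
by exists (u j), a; split=> //; right; exists j.
Qed.

(** * From membership in a generated ideal back to directed paths *)

Lemma generated_ideal_e k l :
  generated_ideal br [set e k] (e l) ->
  has_dipath (induced_subgraph Gamma (range e)) (e k) (e l).
Proof.
set G := induced_subgraph _ _ => kl.
pose P := [set l | has_dipath G (e k) (e l)].
apply: (free_family_mem_span (P := P) free_e).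
have hS := subspace_smallest (e @` P).
move: kl; apply: smallest_sub; last first.
  move=> _ ->; apply: sub_gen_smallest; exists k => //.
  by apply: has_dipath_refl; split; [left|]; exists k.
apply: (ideal_span basis_full) => _ b [m Pm <-] Bb; split; last first.
  by rewrite br_squares_ideal; [exact: subspace0 | exact: squares_ideal_e].
case: Bb => -[j _ <-].
  by rewrite br_squares_ideal; [exact: subspace0 | exact: squares_ideal_e].
(* The remaining product is a multiple of a single [e i]; if nonzero, it is an edge that prolongs
   the path to [e m]. *)
have [_ _ /(_ m j)[i [a h]] _] := hB.
rewrite h; have [->|a0] := eqVneq a 0.
  by rewrite scale0r; exact: subspace0.
apply: (subspaceZ _ hS); apply: sub_gen_smallest; exists i => //.
apply: has_dipath_rcons Pm _ _; first by apply/edge_eP; exists j, a.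
by split; [left|]; exists i.
Qed.

(* The span of the u-vertices reachable from [u i] becomes an ideal only after
   adding the squares ideal, which absorbs the products falling in [F e]. *)
Lemma generated_ideal_u i p :
  generated_ideal br [set u i] (u p) ->
  has_dipath (induced_subgraph Gamma (range u)) (u i) (u p).
Proof.
set G := induced_subgraph _ _ => ip.
pose P := [set l | has_dipath G (u i) (u l)].
apply: (free_family_mem_span (P := P) free_u).
have [subI _] := ideal_generated_ideal br [set br x x | x in setT].
pose S := smallest subspace (I `|` u @` P).
have hS : subspace S := subspace_smallest _.
have IS x : I x -> S x by move=> Ix; apply: sub_gen_smallest; left.
have hSp := subspace_smallest (u @` P).
have : S (u p).
  move: ip; apply: smallest_sub; last first.
    move=> _ ->; apply: sub_gen_smallest; right; exists i => //.
    by apply: has_dipath_refl; split; [right|]; exists i.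
  apply: (ideal_span basis_full) => g b [Ig|[m Pm <-]] Bb; rewrite -/S.
    rewrite (br_squares_ideal b Ig).
    by split; [exact: IS (squares_ideal_brl _ Ig) | exact: (subspace0 hS)].
  case: Bb => -[j _ <-].
    rewrite br_squares_ideal; last exact: squares_ideal_e.
    split; first exact: (subspace0 hS).
    exact: IS (squares_ideal_brl _ (squares_ideal_e j)).
  (* Both orders of the factors are treated at once: a nonzero multiple of [u l] prolongs the path
     to [u m], and a multiple of [e k] falls into [I]. *)
  have step x : x = br (u m) (u j) \/ x = br (u j) (u m) ->
      (exists l a, x = a *: u l) \/ (exists k a, x = a *: e k) ->
      S x.
    move=> xE [[l [a xa]]|[k [a ->]]]; last first.
      by apply: IS; apply: (subspaceZ _ subI); exact: squares_ideal_e.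
    rewrite xa; have [->|a0] := eqVneq a 0.
      by rewrite scale0r; exact: (subspace0 hS).
    apply: (subspaceZ _ hS); apply: sub_gen_smallest; right; exists l => //.
    apply: has_dipath_rcons Pm _ _; last by split; [right|]; exists l.
    apply/edge_uP; exists j, a; split=> //.
    by rewrite -xa; case: xE => ->; [right | left].
  have [_ _ _ hu] := hB.
  by split; apply: step; rewrite ?hu; by [left | right | exact: hu].
(* To discard the summand [I], [u p] is written modulo [I] as a vector [v] in the span of the
   reachable vertices. *)
have hT : subspace [set x | exists2 v, smallest subspace (u @` P) v & I (x - v)].
  apply/subspaceP; split=> [|a x y [v Pv Iv] [w Pw Iw]].
    by exists 0; [exact: (subspace0 hSp) | rewrite subrr; exact: (subspace0 subI)].
  exists (a *: v + w); first exact: (subspaceD hSp (subspaceZ _ hSp Pv) Pw).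
  rewrite opprD addrACA -scalerBr.
  exact: (subspaceD subI (subspaceZ _ subI Iv) Iw).
move=> /(smallest_sub hT) []; first move=> x [Ix|Px].
- by exists 0; [exact: (subspace0 hSp) | rewrite subr0].
- by exists x; [exact: sub_gen_smallest | rewrite subrr; exact: (subspace0 subI)].
move=> v Pv Iv.
have [subV _ _] := hV.
(* Both [u p] and [v] lie in the complement [V], so their difference, being in [I], is zero. *)
have Vv : V v.
  by move: Pv; apply: smallest_sub => // _ [l _ <-]; exact: complement_u.
have /eqP := mem_I_V Iv (subspaceB subV (complement_u p) Vv).
by rewrite subr_eq0 => /eqP ->.
Qed.

End MultiplicativeBasis.
End Leibniz.

Theorem proposition4p1 (F : fieldType) (L : lmodType F)
    (br : {bilinear L -> L -> L}) (V : set L)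
    (K J : Type) (e : K -> L) (u : J -> L)
    (hL : leibniz_identity br)
    (hV : linear_complement (squares_ideal br) V)
    (hB : multiplicative_basis br e u V) :
  let BI := range e in
  let BV := range u in
  let Gamma := product_graph br (BI `|` BV) in
  weak_division br e u <->
  weakly_symmetric (induced_subgraph Gamma BI) /\
  weakly_symmetric (induced_subgraph Gamma BV).
Proof.
move=> BI BV Gamma; split=> [[divI divV]|[symI symV]]; split.
- move=> v w edge; have [_ [/= [k _ vE] [l _ wE]]] := edge; subst v w.
  have [j [a [a0 h]]] := (edge_eP hL hB k l).1 edge.
  (* The return path exists once [e k] lies in the ideal of [e l], which is what weak division says
     of this product. *)
  apply: (generated_ideal_e hL hV hB).
  by apply: (divI _ _ j a _ h); rewrite h; exact: (scale_e_neq0 hB).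
- move=> v w edge; have [_ [/= [i _ vE] [p _ wE]]] := edge; subst v w.
  have [j [a [a0 h]]] := (edge_uP hL hV hB i p).1 edge.
  have up0 : a *: u p != 0.
    apply/eqP => h0; apply: (scale_notin_squares_ideal hV hB (j := p) a0).
    by rewrite h0; exact: (subspace0 (proj1 (ideal_generated_ideal _ _))).
  apply: (generated_ideal_u hL hV hB).
  (* The source [u i] may be either factor; weak division covers both. *)
  by case: h => h; have [] := divV _ _ _ _ _ h; rewrite ?h.
- move=> i k j a n0 h; apply: (has_dipath_ideal (symI _ _ _)).
  apply/(edge_eP hL hB); exists j, a; split=> //.
  by move: n0; rewrite h scaler_eq0 negb_or => /andP[].
- move=> i k p a n0 h.
  have a0 : a != 0 by move: n0; rewrite h scaler_eq0 negb_or => /andP[].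
  (* Each of the two factors is the source of an edge to [u p], with the other factor as
     multiplier. *)
  split; apply: (has_dipath_ideal (symV _ _ _)); apply/(edge_uP hL hV hB).
    by exists k, a; split=> //; right.
  by exists i, a; split=> //; left.
Qed.
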